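(* Let $p,q\in\mathbb{R}[x,y]$ be polynomials with $o(p)>1$ and $o(q)>1$, and let $\Phi:\mathbb{R}^2\to\mathbb{R}^2$, $\Phi(x,y) = (x+p(x,y),\, y+q(x,y))$, be a jacobian map. Suppose that at least one of the following holds: (i) $p$ is $x$-even and $q$ is $x$-odd; (ii) $p$ is $y$-odd and $q$ is $y$-even. Then $\Phi$ is globally invertible.
   Context: All polynomials have real coefficients. For a polynomial $P$, $o(P)$ denotes its order, i.e. the lowest total degree of a monomial occurring in $P$ with nonzero coefficient, with the convention $o(0)=+\infty$ (so $o(P)>1$ means that $P$ has no constant and no degree-one terms). A polynomial map $\Phi:\mathbb{R}^2\to\mathbb{R}^2$ is called a jacobian map if the determinant of its Jacobian matrix is a non-zero constant. Globally invertible means that $\Phi$ is a bijection of $\mathbb{R}^2$ onto $\mathbb{R}^2$. A polynomial is $x$-even if it contains only terms with even powers of $x$ (including power $0$), and $x$-odd if it contains only terms with odd powers of $x$; $y$-even and $y$-odd are defined in the same way with respect to powers of $y$. *)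

(* Defs.v *)
From mathcomp Require Import all_boot all_order all_algebra.
From mathcomp Require Import mpoly.
From mathcomp Require Import reals constructive_ereal.

Set Implicit Arguments.
Unset Strict Implicit.
Unset Printing Implicit Defensive.

Import Order.TTheory GRing.Theory Num.Theory.

Local Open Scope ring_scope.

(* The empty minimum gives [morder 0 = +oo]. *)
Definition morder (n : nat) (R : realType) (p : {mpoly R[n]}) : \bar int :=
  \big[Order.min/+oo%E]_(m <- msupp p) ((mdeg m)%:Z)%:E.

Definition var_even (n : nat) (R : realType) (i : 'I_n) (p : {mpoly R[n]}) :=
  all (fun m : 'X_{1..n} => ~~ odd (m i)) (msupp p).

Definition var_odd (n : nat) (R : realType) (i : 'I_n) (p : {mpoly R[n]}) :=
  all (fun m : 'X_{1..n} => odd (m i)) (msupp p).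

(* The polynomial map R^n -> R^n whose components are the entries of [F]. *)
Definition polymap (n : nat) (R : realType) (F : n.-tuple {mpoly R[n]})
    (v : 'rV[R]_n) : 'rV[R]_n :=
  \row_i (tnth F i).@[v 0].

Definition jacobian_mx (n : nat) (R : realType) (F : n.-tuple {mpoly R[n]}) :
    'M[{mpoly R[n]}]_n :=
  \matrix_(i, j) mderiv j (tnth F i).

Definition jacobian_map (n : nat) (R : realType) (F : n.-tuple {mpoly R[n]}) :=
  exists2 c : R, c != 0 & \det (jacobian_mx F) = c%:MP.

Definition globally_invertible (n : nat) (R : realType)
    (F : n.-tuple {mpoly R[n]}) :=
  bijective (polymap F).

(* Main.v *)
Require Import Defs.
From mathcomp Require Import all_boot all_order all_algebra.
From mathcomp Require Import mpoly ring zify.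
From mathcomp Require Import reals constructive_ereal.

(** The parity hypothesis forces [p] or [q] to vanish, so that the map is a
shear along a coordinate axis, with an explicit inverse.

Exchanging the roles of the two variables turns hypothesis (ii) into (i), so
let [X] be the variable in which the component [P] along [X] is even and the
other component [Q] is odd. The jacobian determinant is
[1 + (P_X + Q_Y) + (P_X Q_Y - P_Y Q_X)], where the first bracket is [X]-odd and
the second is [X]-even. As the determinant is constant, and equal to [1] at the
origin because of the orders, both brackets vanish: the jacobian matrix of
[(P, Q)] has trace and determinant zero ([jacobian_parity_split]).

Now compare degrees in [Y], viewing [P] and [Q] as polynomials in [Y] over
[R[X]]. Suppose [P_Y] and [Q] are nonzero. Since [Q] is [X]-odd, [Q_X] has the
same [Y]-degree as [Q], and [Q_Y ^ 2 = - P_Y Q_X] gives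
[deg Q = deg P + 1 = t + 1]. Let [a], [b] in [R[X]] be the leading coefficients
of [P], [Q]. Then [a' = - (t + 1) b] and [a' ^ 2 = - t a b'], hence
[(t + 1) a' ^ 2 = t a a'']. For [a] of degree [d > 0], the top coefficients
would give [(t + 1) d = t (d - 1)], which is absurd; so [a' = 0] and [b = 0], a
contradiction ([deriv_sqr_balance], [nilpotent_jacobian_degenerate]).

So [P_Y = 0] or [Q = 0]. If [P_Y = 0], then [Q_Y ^ 2 = 0], so [P_X = 0] too and
[P], having no constant term, is zero. Hence the map is either [(X + P(Y), Y)]
or [(X, Y + Q(X))] ([jacobian_even_odd], [shear_bijective]). *)

Import Order.TTheory GRing.Theory Num.Theory.

Local Open Scope ring_scope.

(* A bivariate polynomial is an element of [{poly {poly D}}]: the outer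
   indeterminate is Y, and X is the indeterminate of the coefficients. *)
Local Notation dX := (map_poly (@deriv _)).
Local Notation reflX := (map_poly (comp_poly (- 'X))).

(** * Derivatives in characteristic zero *)

Lemma mulrn_char0_eq0 (D : idomainType) (hD : [pchar D] =i pred0) (x : D) n :
  (x *+ n == 0) = (n == 0)%N || (x == 0).
Proof. by rewrite -mulr_natl mulf_eq0 ((pcharf0P D).1 hD). Qed.

Lemma pchar_poly_char0 (D : idomainType) (hD : [pchar D] =i pred0) :
  [pchar {poly D}] =i pred0.
Proof. by move=> n; rewrite pchar_poly hD. Qed.

Lemma size_deriv_char0 (D : idomainType) (hD : [pchar D] =i pred0)
    (p : {poly D}) :
  size p^`() = (size p).-1.
Proof.
have [->|p0] := eqVneq p 0; first by rewrite linear0 size_poly0.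
apply/eqP; rewrite eqn_leq -ltnS prednK ?size_poly_gt0 // lt_size_deriv //=.
case Es: (size p) => [//|[//|n]] /=.
rewrite ltnNge; apply: contra p0 => /leq_sizeP/(_ n (leqnn n))/eqP.
by rewrite coef_deriv mulrn_char0_eq0 //= -lead_coef_eq0 lead_coefE Es.
Qed.

Lemma lead_coef_deriv_char0 (D : idomainType) (hD : [pchar D] =i pred0)
    (p : {poly D}) :
  lead_coef p^`() = lead_coef p *+ (size p).-1.
Proof.
rewrite !lead_coefE size_deriv_char0 // coef_deriv.
by case Es: (size p) => [|[|n]] //=; rewrite [p`_1]nth_default ?Es.
Qed.

Lemma deriv_eq0_char0 (D : idomainType) (hD : [pchar D] =i pred0)
    (p : {poly D}) :
  p^`() = 0 -> p = (p`_0)%:P.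
Proof.
move=> p0; apply: size1_polyC.
by have := size_deriv_char0 _ hD p; rewrite p0 size_poly0; case: size => [|[]].
Qed.

(** With [l] the leading coefficient of [a] and [e > 0] its degree, the
coefficient of degree [2 e - 2] of the identity reads
[(n + 1) e ^ 2 l ^ 2 = n e (e - 1) l ^ 2], but [n (e - 1) < (n + 1) e]. *)
Lemma deriv_sqr_balance (D : idomainType) (hD : [pchar D] =i pred0)
    (a : {poly D}) n :
  a^`() ^+ 2 *+ n.+1 = (a * a^`()^`()) *+ n -> a^`() = 0.
Proof.
rewrite -[LHS]mulr_natl -[RHS]mulr_natl => /(congr1 (@lead_coef _)).
rewrite !lead_coefM -!polyC_natr !lead_coefC !lead_coef_deriv_char0 //.
rewrite size_deriv_char0 //.
case Es: (size a).-1 => [|d].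
  by move=> _; apply/eqP; rewrite -size_poly_eq0 size_deriv_char0 // Es.
set l := lead_coef a => El.
have /eqP : l ^+ 2 *+ (d.+1 * (n + d.+1)) = 0.
  rewrite -mulr_natr natrM natrD.
  (* (n + 1) (d + 1)^2 - n (d + 1) d = (d + 1) (n + d + 1) *)
  transitivity (n.+1%:R * (l *+ d.+1 * (l *+ d.+1))
                - n%:R * (l * (l *+ d.+1 *+ d))).
    rewrite -[l *+ d.+1]mulr_natr -[_ *+ d]mulr_natr.
    by rewrite -[in n.+1%:R]natr1 -[in d.+1%:R]natr1; ring.
  by rewrite El subrr.
rewrite mulrn_char0_eq0 // muln_eq0 addnS /= sqrf_eq0 lead_coef_eq0.
by move=> /eqP a0; move: Es; rewrite a0 size_poly0.
Qed.

(** * Jacobian matrices of trace and determinant zero *)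

(** The first hypothesis keeps the Y-degree of [Q] from dropping under [dX]. It
excludes nilpotent examples such as [P = Q = (X - Y) ^+ 2], where neither
conclusion holds. *)
Lemma nilpotent_jacobian_degenerate (D : idomainType) (hD : [pchar D] =i pred0)
    (P Q : {poly {poly D}}) :
  (forall j, (Q`_j)^`() = 0 -> Q`_j = 0) ->
  dX P + Q^`() = 0 ->
  dX P * Q^`() = P^`() * dX Q ->
  P^`() = 0 \/ Q = 0.
Proof.
move=> nzQ trace0 det0; have hD2 := pchar_poly_char0 _ hD.
have [P0|P0] := eqVneq P^`() 0; [by left | right].
apply/eqP; apply: contraT => Q0.
have EPx : dX P = - Q^`() by apply/eqP; rewrite -addr_eq0 trace0.
have b'0 : (lead_coef Q)^`() != 0.
  by apply: contra Q0 => /eqP /nzQ /eqP; rewrite lead_coef_eq0.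
have sQx : size (dX Q) = size Q by apply: size_map_poly_id0.
have Qx0 : dX Q != 0.
  by rewrite -size_poly_eq0 sQx size_poly_eq0.
have Esq : Q^`() * Q^`() = - (P^`() * dX Q).
  by rewrite -det0 EPx mulNr opprK.
have Q'0 : Q^`() != 0.
  apply: contraNneq (mulf_neq0 P0 Qx0) => Q'0.
  by rewrite -oppr_eq0 -Esq Q'0 mul0r.
have sP0 : (0 < size P^`())%N by rewrite size_poly_gt0.
have sQ0 : (0 < size Q^`())%N by rewrite size_poly_gt0.
have Es : size Q = (size P).+1.
  have := congr1 (fun p : {poly _} => size p) Esq.
  rewrite size_polyN !size_mul // sQx.
  move: sP0 sQ0; rewrite !(size_deriv_char0 _ hD2).
  move: (size P) (size Q) => t s; lia.
have [t Et] : exists t, size P = t.+1.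
  move: sP0; rewrite size_deriv_char0 //.
  by case: (size P) => [|t] // _; exists t.
set a := lead_coef P; set b := lead_coef Q.
have Ea : a^`() = - (b *+ t.+1).
  rewrite /b -Et -[size P]/(size P).+1.-1 -Es -lead_coef_deriv_char0 //.
  rewrite -lead_coefN -EPx /a !lead_coefE EPx size_polyN.
  by rewrite size_deriv_char0 // Es -EPx coef_map.
have Eab : a^`() ^+ 2 = - (a *+ t * b^`()).
  have := congr1 (@lead_coef _) Esq.
  rewrite lead_coefN !lead_coefM lead_coef_deriv_char0 // Es /=.
  rewrite lead_coef_deriv_char0 // Et /= -/a -/b.
  rewrite [lead_coef (map_poly _ _)]lead_coefE sQx coef_map -/b => <-.
  by rewrite Ea sqrrN expr2.
have /eqP : a^`() = 0.
  apply: (@deriv_sqr_balance _ hD _ t).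
  rewrite Eab Ea derivN derivMn mulrN !mulNrn mulrnAl mulrnAr.
  by rewrite -!mulrnA mulnC.
by rewrite Ea oppr_eq0 mulrn_char0_eq0 //= lead_coef_eq0 (negPf Q0).
Qed.

(** * Splitting the jacobian condition by parity *)

Lemma comp_polyNX_parity (D : comNzRingType) (a : {poly D}) (s : bool) :
  (forall i, odd i != s -> a`_i = 0) -> a \Po (- 'X) = (-1) ^+ s *: a.
Proof.
move=> ha; rewrite comp_polyE -[in RHS](coefK a) poly_def scaler_sumr.
apply: eq_bigr => i _.
have [<-|/ha ->] := eqVneq (odd i) s; last by rewrite !scale0r scaler0.
rewrite [(- 'X) ^+ i]exprNn -[(-1) ^+ i]signr_odd.
case: (odd i); rewrite /= ?expr1 ?expr0.
  by rewrite mulN1r scalerN scaleN1r.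
by rewrite mul1r scale1r.
Qed.

Lemma reflX_dX (D : comNzRingType) (P : {poly {poly D}}) :
  reflX (dX P) = - dX (reflX P).
Proof.
apply/polyP => j; rewrite coefN !coef_map /= deriv_comp derivN derivX.
by rewrite mulrN1 opprK.
Qed.

Lemma reflX_parity (D : comNzRingType) (P : {poly {poly D}}) (s : bool) :
  (forall j i, odd i != s -> P`_j`_i = 0) ->
  reflX P = (-1) ^+ s * P.
Proof.
move=> hP; apply/polyP => j; rewrite coef_map /=.
rewrite (comp_polyNX_parity _ _ s (hP j)).
case: s {hP}; rewrite /= ?expr1 ?expr0.
  by rewrite scaleN1r mulN1r coefN.
by rewrite scale1r mul1r.
Qed.

(** The substitution of [- X] for [X] changes the sign of [dX P] and of [Q^`()],
and fixes the products [dX P * Q^`()] and [P^`() * dX Q]. The two conclusions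
are half the difference and half the sum of the equation and its image. *)
Lemma jacobian_parity_split (D : idomainType) (hD : [pchar D] =i pred0)
    (P Q : {poly {poly D}}) (c : D) :
  (forall j i, odd i -> P`_j`_i = 0) ->
  (forall j i, ~~ odd i -> Q`_j`_i = 0) ->
  (1 + dX P) * (1 + Q^`()) - P^`() * dX Q = c%:P%:P ->
  dX P + Q^`() = 0 /\ 1 + (dX P * Q^`() - P^`() * dX Q) = c%:P%:P.
Proof.
move=> hP hQ E.
have sP : reflX P = P.
  rewrite (reflX_parity _ P false) ?mul1r // => j i.
  by rewrite eqbF_neg negbK; apply: hP.
have sQ : reflX Q = - Q.
  rewrite (reflX_parity _ Q true) ?expr1 ?mulN1r // => j i.
  by rewrite eqb_id; apply: hQ.
have := congr1 reflX E.
rewrite rmorphB !rmorphM !rmorphD rmorph1 /= !reflX_dX -!deriv_map sP sQ.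
rewrite map_polyC /= comp_polyC derivN raddfN opprK => /esym /(etrans E).
move: E; set u := dX P; set v := Q^`(); set w := _ * dX Q => E E'.
have E0 : u + v = 0.
  apply/eqP; have : (u + v) *+ 2 == 0.
    move/eqP: E'; rewrite -subr_eq0; congr (_ == 0).
    rewrite /w; ring.
  by rewrite mulrn_char0_eq0 //; do 2 apply: pchar_poly_char0.
split=> //; rewrite -E -[LHS]addr0 -E0; ring.
Qed.

(** The linear part of [P] at the origin vanishes, its X-term by parity, whence
[c = 1]. When [P] does not involve Y, the zero determinant reads
[Q^`() ^+ 2 = 0], so that [P] is a constant. *)
Lemma jacobian_even_odd (D : idomainType) (hD : [pchar D] =i pred0)
    (P Q : {poly {poly D}}) (c : D) :
  (forall j i, odd i -> P`_j`_i = 0) ->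
  (forall j i, ~~ odd i -> Q`_j`_i = 0) ->
  P`_0`_0 = 0 -> P`_1`_0 = 0 ->
  (1 + dX P) * (1 + Q^`()) - P^`() * dX Q = c%:P%:P ->
  (dX P = 0 /\ Q = 0) \/ (P = 0 /\ Q^`() = 0).
Proof.
move=> hP hQ P00 P10 E; have hD2 := pchar_poly_char0 _ hD.
have [E0 E1] := jacobian_parity_split _ hD _ _ _ hP hQ E.
have EPx : dX P = - Q^`() by apply/eqP; rewrite -addr_eq0 E0.
have c1 : c = 1.
  have := congr1 (fun z : {poly {poly D}} => z`_0`_0) E1.
  have Px00 : (dX P)`_0`_0 = 0 by rewrite coef_map /= coef_deriv hP // mul0rn.
  have Py00 : P^`()`_0`_0 = 0 by rewrite coef_deriv coefMn P10 mul0rn.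
  rewrite coefD coefB !coef0M coefD coefB !coef0M Px00 Py00 !mul0r subr0 addr0.
  by rewrite !coefC !eqxx => <-.
have {E1} det0 : dX P * Q^`() = P^`() * dX Q.
  by apply/eqP; rewrite -subr_eq0 -(inj_eq (addrI 1)) E1 c1 addr0.
have [|P'0|Q0] := @nilpotent_jacobian_degenerate _ hD P Q _ E0 det0.
- by move=> j /deriv_eq0_char0 -> //; rewrite hQ ?polyC0.
- have Q'0 : Q^`() = 0.
    move/eqP: det0; rewrite P'0 mul0r EPx mulNr oppr_eq0 mulf_eq0 orbb.
    by move=> /eqP.
  right; split=> //; have EP := deriv_eq0_char0 _ hD2 P P'0.
  have : (P`_0)^`() = 0.
    have := congr1 (fun z : {poly {poly D}} => z`_0) EPx.
    by rewrite Q'0 oppr0 coef_map coef0.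
  by move=> /deriv_eq0_char0 E00; rewrite EP E00 // P00.
- by left; rewrite EPx Q0 linear0 oppr0.
Qed.

(** * From multivariate to nested polynomials *)

(** The variable of index [k] becomes X, the other one becomes Y, so that one
statement about nested polynomials covers both parity hypotheses. *)
Definition bivariate (R : comNzRingType) (k : 'I_2) :
    {mpoly R[2]} -> {poly {poly R}} :=
  mmap (polyC \o polyC) (fun l => if l == k then 'X%:P else 'X).

Definition mnm2 (k : 'I_2) (i j : nat) : 'X_{1..2} :=
  [multinom if l == k then i else j | l < 2].

Lemma ord2_neq (k l : 'I_2) : l != k -> l = rev_ord k.
Proof. by case: k l => [[|[|?]] //= ?] [[|[|?]] //= ?] // _; apply/val_inj. Qed.

Lemma rev_ord2_neq (k : 'I_2) : (rev_ord k == k) = false.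
Proof. by case: k => [[|[|?]] //= ?]. Qed.

Lemma mnm2_eq (k : 'I_2) i j (m : 'X_{1..2}) :
  (m == mnm2 k i j) = (i == m k) && (j == m (rev_ord k)).
Proof.
apply/eqP/andP => [->|[/eqP-> /eqP->]].
  by rewrite !mnmE eqxx rev_ord2_neq !eqxx.
by apply/mnmP => l; rewrite mnmE; case: eqVneq => [->|/ord2_neq ->].
Qed.

(** Parity, order and partial derivatives are all read off coefficients, so they
transfer to nested polynomials through this formula. *)
Lemma coef_bivariate (R : comNzRingType) k (p : {mpoly R[2]}) i j :
  (bivariate R k p)`_j`_i = p@_(mnm2 k i j).
Proof.
rewrite {1}/bivariate {1}(mpolyE p) raddf_sum /= !coef_sum.
rewrite [in RHS](mpolyE p) raddf_sum /=; apply: eq_bigr => m _.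
rewrite mmapZ mmapX linearZ /= mcoeffX mnm2_eq /mmap1 (bigD1 k) //=.
rewrite (bigD1 (rev_ord k)) ?rev_ord2_neq //= big1 ?mulr1; last first.
  by move=> l /andP[/ord2_neq ->]; rewrite eqxx.
rewrite eqxx -polyC_exp !coefCM coefXn mulr_natr coefMn coefXn.
by case: (i == _); case: (j == _).
Qed.

Lemma bivariate_mderiv_inner (R : comNzRingType) k (p : {mpoly R[2]}) :
  bivariate R k p^`M(k) = dX (bivariate R k p).
Proof.
apply/polyP => j; rewrite coef_map; apply/polyP => i /=.
rewrite coef_deriv !coef_bivariate mcoeff_deriv mnmE eqxx; congr (p@_ _ *+ _).
apply/eqP; rewrite mnm2_eq !mnmDE !mnm1E !mnmE eqxx [k == _]eq_sym rev_ord2_neq.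
by rewrite addn1 addn0 !eqxx.
Qed.

Lemma bivariate_mderiv_outer (R : comNzRingType) k (p : {mpoly R[2]}) :
  bivariate R k p^`M(rev_ord k) = (bivariate R k p)^`().
Proof.
apply/polyP => j; rewrite coef_deriv; apply/polyP => i /=.
rewrite coefMn !coef_bivariate mcoeff_deriv mnmE rev_ord2_neq.
congr (p@_ _ *+ _).
apply/eqP; rewrite mnm2_eq !mnmDE !mnm1E !mnmE !eqxx rev_ord2_neq.
by rewrite addn1 addn0 !eqxx.
Qed.

Lemma bivariate_inj0 (R : comNzRingType) k (p : {mpoly R[2]}) :
  bivariate R k p = 0 -> p = 0.
Proof.
move=> p0; apply/mpolyP => m; rewrite mcoeff0.
have -> : m = mnm2 k (m k) (m (rev_ord k)).
  by apply/eqP; rewrite mnm2_eq !eqxx.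
by rewrite -coef_bivariate p0 !coef0.
Qed.

Lemma morder_gt1_mcoeff n (R : realType) (p : {mpoly R[n]}) m :
  (1 < morder p)%E -> (mdeg m <= 1)%N -> p@_m = 0.
Proof.
move=> hp hm; apply: memN_msupp_eq0; apply/negP => mp.
have : (morder p <= ((mdeg m)%:Z)%:E)%E.
  exact: (@ge_bigmin_seq _ _ _ _ _ m predT (fun m => ((mdeg m)%:Z)%:E)).
by move=> /(lt_le_trans hp); rewrite lte_fin; lia.
Qed.

Lemma mdeg_mnm2 k i j : mdeg (mnm2 k i j) = (i + j)%N.
Proof.
rewrite mdegE (bigD1 k) //= (bigD1 (rev_ord k)) ?rev_ord2_neq //=.
rewrite big1; last first.
  by move=> l /andP[/ord2_neq ->]; rewrite eqxx.
by rewrite !mnmE eqxx rev_ord2_neq addn0.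
Qed.

Lemma jacobian_parity_dichotomy (R : realType) (k : 'I_2)
    (f g : {mpoly R[2]}) (c : R) :
  (1 < morder f)%E -> var_even k f -> var_odd k g ->
  (1 + f^`M(k)) * (1 + g^`M(rev_ord k)) - f^`M(rev_ord k) * g^`M(k) = c%:MP ->
  (f^`M(k) = 0 /\ g = 0) \/ (f = 0 /\ g^`M(rev_ord k) = 0).
Proof.
move=> hf /allP evf /allP odg /(congr1 (bivariate R k)).
rewrite /bivariate rmorphB !rmorphM !rmorphD rmorph1 /= mmapC -/(bivariate R k).
rewrite !bivariate_mderiv_inner !bivariate_mderiv_outer => E.
have [||||[Px Q0]|[P0 Qy]] :=
  @jacobian_even_odd R (pchar_num R) _ _ c _ _ _ _ E.
- move=> j i oi; rewrite coef_bivariate; apply: memN_msupp_eq0.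
  by apply/negP => /evf; rewrite mnmE eqxx oi.
- move=> j i ei; rewrite coef_bivariate; apply: memN_msupp_eq0.
  by apply/negP => /odg; rewrite mnmE eqxx (negPf ei).
- by rewrite coef_bivariate (morder_gt1_mcoeff _ _ _ _ hf) ?mdeg_mnm2.
- by rewrite coef_bivariate (morder_gt1_mcoeff _ _ _ _ hf) ?mdeg_mnm2.
- left; split; apply: (@bivariate_inj0 _ k) => //.
  by rewrite bivariate_mderiv_inner.
- right; split; apply: (@bivariate_inj0 _ k) => //.
  by rewrite bivariate_mderiv_outer.
Qed.

(** * Shears *)

Lemma eq_meval_mderiv0 n (R : numDomainType) (k : 'I_n) (p : {mpoly R[n]})
    (u v : 'I_n -> R) :
  p^`M(k) = 0 -> (forall i, i != k -> u i = v i) -> p.@[u] = p.@[v].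
Proof.
move=> pk0 uv; rewrite !mevalE; apply: eq_big_seq => m mp; congr (_ * _).
apply: eq_bigr => i _; have [->|/uv -> //] := eqVneq i k.
suff -> : m k = 0%N by rewrite !expr0.
apply/eqP; apply: contraLR mp => mk0; rewrite mcoeff_msupp negbK.
have := mcoeff_deriv k (m - U_(k))%MM p.
by rewrite pk0 mcoeff0 submK ?lep1mP // => /esym/eqP; rewrite mulrn_eq0.
Qed.

Lemma shear_bijective n (R : numDomainType) (k : 'I_n) (p : {mpoly R[n]}) :
  p^`M(k) = 0 ->
  bijective (fun v : 'rV[R]_n => v + p.@[v 0] *: delta_mx 0 k).
Proof.
move=> pk0; have inv (a : R) (v : 'rV[R]_n) :
    p.@[(v + a *: delta_mx 0 k) 0] = p.@[v 0].
  apply: (eq_meval_mderiv0 _ _ k) => // i ik.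
  by rewrite !mxE (negPf ik) andbF mulr0 addr0.
exists (fun v : 'rV[R]_n => v - p.@[v 0] *: delta_mx 0 k) => v.
  by rewrite inv addrK.
by rewrite -scaleNr inv scaleNr subrK.
Qed.

(** * The jacobian determinant in the plane *)

Lemma det_mx2 (A : comNzRingType) (M : 'M[A]_2) :
  \det M = M 0 0 * M 1 1 - M 0 1 * M 1 0.
Proof.
rewrite (expand_det_row _ 0) !big_ord_recl big_ord0 addr0.
rewrite /cofactor !det_mx11 !mxE /=.
rewrite expr0 expr1 mul1r mulN1r mulrN.
by congr (_ * M _ _ - M _ _ * M _ _); apply/val_inj.
Qed.

Lemma mderiv_XD n (A : nzRingType) (i j : 'I_n) (p : {mpoly A[n]}) :
  ('X_i + p)^`M(j) = (i == j)%:R + p^`M(j).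
Proof.
rewrite mderivD mderivX mnm1E; congr (_ + _).
case: eqP => [->|_]; rewrite ?scale0r // scale1r.
by rewrite -[X in (X - _)%MM]add0m addmK mpolyX0.
Qed.

Lemma det_jacobian_planar (R : realType) (p q : {mpoly R[2]}) :
  \det (jacobian_mx [tuple 'X_0 + p; 'X_1 + q]) =
  (1 + p^`M(0)) * (1 + q^`M(1)) - p^`M(1) * q^`M(0).
Proof.
by rewrite det_mx2 !mxE !(tnth_nth 0) /= !mderiv_XD /= !add0r.
Qed.

(* The variables x and y are 'X_0 and 'X_1. *)
Theorem theorem2 (R : realType) (p q : {mpoly R[2]})
    (hp : (1 < morder p)%E) (hq : (1 < morder q)%E)
    (hJ : jacobian_map [tuple 'X_0 + p; 'X_1 + q])
    (hpar : (var_even 0 p /\ var_odd 0 q) \/ (var_odd 1 p /\ var_even 1 q)) :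
  globally_invertible [tuple 'X_0 + p; 'X_1 + q].
Proof.
case: hJ => c _; rewrite det_jacobian_planar => hdet.
have rev0 : rev_ord 0 = 1 :> 'I_2 by apply/val_inj.
have rev1 : rev_ord 1 = 0 :> 'I_2 by apply/val_inj.
have [[Px0 q0]|[p0 Qy0]] : (p^`M(0) = 0 /\ q = 0) \/ (p = 0 /\ q^`M(1) = 0).
- case: hpar => [[ep oq]|[op eq]].
    have := jacobian_parity_dichotomy R 0 p q c hp ep oq.
    by rewrite rev0; apply.
  (* The transposition of the variables exchanges the two components. *)
  have := jacobian_parity_dichotomy R 1 q p c hq eq op; rewrite rev1.
  by case=> [|[]|[]]; [rewrite -hdet; ring | right | left].
- apply: (eq_bij (shear_bijective _ _ 0 p Px0)) => v; apply/rowP => i.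
  rewrite !mxE (tnth_nth 0) q0.
  by case: i => [[|[|?]] //= ?]; rewrite mevalD mevalXU ?meval0 ?mulr1 ?mulr0;
    congr (v _ _ + _); apply/val_inj.
- apply: (eq_bij (shear_bijective _ _ 1 q Qy0)) => v; apply/rowP => i.
  rewrite !mxE (tnth_nth 0) p0.
  by case: i => [[|[|?]] //= ?]; rewrite mevalD mevalXU ?meval0 ?mulr1 ?mulr0;
    congr (v _ _ + _); apply/val_inj.
Qed.
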